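(* Let $n\geq 3$ be an integer and let $(d_1^1,\ldots,d_n^1)$ and $(d_1^2,\ldots,d_n^2)$ be two graphic sequences (each weakly decreasing) with $d_n^1\geq 1$ and $d_n^2\geq 1$. If $d_1^1 d_1^2 < \frac{n}{2}$, then $(d_1^1,\ldots,d_n^1)$ and $(d_1^2,\ldots,d_n^2)$ pack.
   Context: A weakly decreasing sequence $(d_1,\ldots,d_n)$ of non-negative integers is graphic if there is a simple graph $G$ with $V(G)=[n]$ and $\deg_G(i)=d_i$ for all $i\in[n]$. Two graphic sequences $(d_1^1,\ldots,d_n^1)$ and $(d_1^2,\ldots,d_n^2)$ pack if there are edge-disjoint simple graphs $G_1,G_2$ on the same vertex set $[n]$ with $\deg_{G_j}(i)=d_i^j$ for all $i\in[n]$ and $j\in\{1,2\}$. *)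

(* Defs.v *)
From mathcomp Require Import all_boot all_order all_algebra.
Set Implicit Arguments.
Unset Strict Implicit.
Unset Printing Implicit Defensive.

(* A simple graph on the vertex set T is given by its adjacency relation. *)
Definition simple_graph (T : finType) (e : rel T) : Prop :=
  symmetric e /\ irreflexive e.

Definition degree (T : finType) (e : rel T) (x : T) : nat :=
  #|[set y | e x y]|.

Definition edge_disjoint (T : finType) (e1 e2 : rel T) : Prop :=
  forall x y : T, ~~ (e1 x y && e2 x y).

(* The vertex set [n] is represented by 'I_n, so entries are indexed from 0. *)
Definition realizes (n : nat) (e : rel 'I_n) (d : n.-tuple nat) : Prop :=
  simple_graph e /\ forall i : 'I_n, degree e i = tnth d i.

Definition graphic (n : nat) (d : n.-tuple nat) : Prop :=
  sorted geq d /\ exists e : rel 'I_n, realizes e d.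

Definition pack (n : nat) (d1 d2 : n.-tuple nat) : Prop :=
  exists e1 e2 : rel 'I_n,
    [/\ realizes e1 d1, realizes e2 d2 & edge_disjoint e1 e2].

(* Main.v *)
Require Import Defs.
From mathcomp Require Import all_boot all_order all_algebra.
From mathcomp Require Import zify.
Import Order.TTheory GRing.Theory Num.Theory.
Set Implicit Arguments.
Unset Strict Implicit.
Unset Printing Implicit Defensive.

(** Take realizations with as few common edges as possible, and let D1 <= D2 be
    the maximum degrees. If uv is a common edge, the switch replacing the edges
    uv, wb of the first graph by ub, vw keeps the degrees and removes a common
    edge, provided that w is not adjacent to v, and b not adjacent to u, in
    either graph. A vertex w for which no such b exists is u or v, or a
    neighbour of v, or (as w is not isolated) is within one edge of the first
    graph from a neighbour of u. There are at most
    2 + (D1 - 1) + (D2 - 1) + (D1 - 1)^2 + (D2 - 1) D1 <= 2 D1 D2 < n of these. *)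

Section Switch.
Variable T : finType.
Implicit Types (e : rel T) (u v w b x y : T).

Definition same_pair (p q x y : T) : bool :=
  (x == p) && (y == q) || (x == q) && (y == p).

Definition switch e u v w b : rel T := fun x y =>
  [|| same_pair u b x y, same_pair v w x y
    | [&& e x y, ~~ same_pair u v x y & ~~ same_pair w b x y]].

Lemma same_pairC p q x y : same_pair p q x y = same_pair p q y x.
Proof. by rewrite /same_pair orbC [in LHS]andbC [(x == p) && _]andbC. Qed.

(** The removed edges [u v], [w b] and the added edges [u b], [v w] alternate around the 4-cycle
    [u v w b]. Its symmetries carry each vertex to the place of [u], so degrees need to be computed
    only there. *)
Lemma switch_rotate e u v w b :
  [/\ switch e v u b w =2 switch e u v w b,
      switch e w b u v =2 switch e u v w b
    & switch e b w v u =2 switch e u v w b].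
Proof.
have swap p q x y : same_pair p q x y = same_pair q p x y.
  by rewrite /same_pair orbC.
split=> x y; rewrite /switch.
- by rewrite orbCA (swap v u) (swap b w).
- by rewrite orbCA (swap w v) (swap b u) [~~ _ && ~~ _]andbC.
- by rewrite (swap w v) (swap b u) (swap b w) (swap v u) [~~ _ && ~~ _]andbC.
Qed.

Lemma degree_eq e e' x : e x =1 e' x -> degree e x = degree e' x.
Proof. by move=> ee'; apply: eq_card => y; rewrite !inE ee'. Qed.

Section SwitchTheory.
Variables (e : rel T) (u v w b : T).
Hypotheses (sym_e : symmetric e) (irr_e : irreflexive e).
Hypotheses (uv : e u v) (Nub : ~~ e u b).
Hypotheses (neq_uw : u != w) (neq_vw : v != w) (neq_ub : u != b).

Let neq_uv : u != v. Proof. by apply: contraTneq uv => ->; rewrite irr_e. Qed.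

Lemma simple_switch : simple_graph (switch e u v w b).
Proof.
split=> x; first by move=> y; rewrite /switch !(same_pairC _ _ x y) sym_e.
rewrite /switch irr_e /same_pair /= orbF; apply/negP.
by case/orP=> /orP[] /andP[/eqP-> ]; apply/negP; rewrite // eq_sym.
Qed.

(** At [u] the neighbour [v] is traded for [b], which was not a neighbour before. *)
Lemma degree_switch_end : degree (switch e u v w b) u = degree e u.
Proof.
have -> : degree (switch e u v w b) u = #|b |: ([set y | e u y] :\ v)|.
  apply: eq_card => y; rewrite !inE /switch /same_pair eqxx (negPf neq_uv).
  by rewrite (negPf neq_uw) (negPf neq_ub) /= ?orbF ?andbT andbC.
by rewrite cardsU1 !inE (negPf Nub) andbF /= /degree [in RHS](cardsD1 v) inE uv.
Qed.

End SwitchTheory.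

Lemma degree_switch e u v w b : symmetric e -> irreflexive e ->
    e u v -> e w b -> ~~ e u b -> ~~ e v w -> u != w -> v != w -> u != b ->
  degree (switch e u v w b) =1 degree e.
Proof.
move=> sym_e irr_e uv wb Nub Nvw neq_uw neq_vw neq_ub x.
have neq_vb : v != b by apply: contraNneq Nub => <-.
have [rot1 rot2 rot3] := switch_rotate e u v w b.
have [->|xu] := eqVneq x u; first exact: degree_switch_end.
have [->|xv] := eqVneq x v.
  by rewrite -(degree_eq (rot1 v)) degree_switch_end // sym_e.
have [->|xw] := eqVneq x w.
  by rewrite -(degree_eq (rot2 w)) degree_switch_end // 1?sym_e // eq_sym.
have [->|xb] := eqVneq x b.
  by rewrite -(degree_eq (rot3 b)) degree_switch_end // 1?sym_e // eq_sym.
apply: degree_eq => y; rewrite /switch /same_pair.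
by rewrite (negPf xu) (negPf xv) (negPf xw) (negPf xb) /= andbT.
Qed.

Lemma card_bigcup_leq (A : {set T}) (F : T -> {set T}) k :
  {in A, forall s, #|F s| <= k} -> #|\bigcup_(s in A) F s| <= #|A| * k.
Proof.
move=> leFk; rewrite -sum_nat_const.
apply: (@big_ind2 _ _ (fun (X : {set T}) m => #|X| <= m)) => //.
  by rewrite cards0.
by move=> X m Y p leXm leYp; rewrite (leq_trans (leq_card_setU _ _)) ?leq_add.
Qed.

Lemma exists_switch (e1 e2 : rel T) (D1 D2 : nat) u v :
    simple_graph e1 -> simple_graph e2 ->
    (forall x, 0 < degree e1 x <= D1) -> (forall x, degree e2 x <= D2) ->
    D1 <= D2 -> 2 * (D1 * D2) < #|T| -> e1 u v -> e2 u v ->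
  exists w b, [/\ e1 w b, ~~ e1 u b, ~~ e2 u b &
                  [/\ ~~ e1 v w, ~~ e2 v w, u != w, v != w & u != b]].
Proof.
move=> [sym1 irr1] [sym2 irr2] deg1 deg2 leD ltT uv1 uv2.
pose N1 x := [set y | e1 x y]; pose N2 x := [set y | e2 x y].
(* A neighbour s of u in e1 accounts for its other neighbours, or for itself
   when it is a leaf; this saves one vertex over N1 s. *)
pose F s := if N1 s :\ u == set0 then [set s] else N1 s :\ u.
(* [B] collects the bad choices of [w]. Both unions skip [s = v], since the neighbours of [v] in
   [e1] are in [B] already. *)
pose B := [set u; v] :|: (N1 v :\ u) :|: (N2 v :\ u)
  :|: \bigcup_(s in N1 u :\ v) F s :|: \bigcup_(s in N2 u :\ v) N1 s.
have cardN1 x y : e1 x y -> #|N1 x :\ y| < D1.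
  move=> xy; have /andP[_] := deg1 x.
  by rewrite /degree (cardsD1 y) inE xy.
have cardN2 x y : e2 x y -> #|N2 x :\ y| < D2.
  by move=> xy; have := deg2 x; rewrite /degree (cardsD1 y) inE xy.
have leF : #|\bigcup_(s in N1 u :\ v) F s| <= #|N1 u :\ v| * D1.-1.
  apply: card_bigcup_leq => s sP; have := sP; rewrite !inE => /andP[_ us].
  (* If [F s] is a singleton, the bound needs [D1 >= 2]; this holds because [u] has the two distinct
     neighbours [s] and [v]. *)
  have ltu := cardN1 u v uv1.
  have u_gt0 : 0 < #|N1 u :\ v| by apply/card_gt0P; exists s.
  rewrite /F; case: ifP => _; first by rewrite cards1; lia.
  by have := cardN1 s u; rewrite sym1 us => /(_ isT); lia.
have leG : #|\bigcup_(s in N2 u :\ v) N1 s| <= #|N2 u :\ v| * D1.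
  by apply: card_bigcup_leq => s _; have /andP[] := deg1 s.
have ltB : #|B| < #|T|.
  apply: leq_ltn_trans ltT.
  have leB : #|B| <= #|[set u; v]| + #|N1 v :\ u| + #|N2 v :\ u|
      + #|\bigcup_(s in N1 u :\ v) F s| + #|\bigcup_(s in N2 u :\ v) N1 s|.
    by do 4![apply: leq_trans (leq_card_setU _ _) _; rewrite ?leq_add2r].
  apply: leq_trans leB _.
  have := cards2 u v; have := leq_b1 (u != v).
  have := cardN1 u v uv1; have := cardN2 u v uv2.
  have := cardN1 v u; have := cardN2 v u.
  rewrite sym1 sym2 => /(_ uv2) h2 /(_ uv1) h1 h4 h3 hb ->.
  (* With every cardinal replaced by its bound, the inequality reduces to
     [(D1 - 1)^2 <= (D1 - 1) * D2], which follows from [D1 <= D2]. *)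
  have : #|N1 u :\ v| * D1.-1 <= D1.-1 * D1.-1 by rewrite leq_mul //; lia.
  have : #|N2 u :\ v| * D1 <= D2.-1 * D1 by rewrite leq_mul //; lia.
  nia.
have /card_gt0P[w] : 0 < #|~: B| by rewrite cardsCs setCK subn_gt0.
rewrite in_setC /B !in_setU !negb_or.
case/andP=> /andP[/andP[/andP[/andP[wu wv] Nvw1] Nvw2] wF] wG.
move: wu wv Nvw1 Nvw2; rewrite !inE => wu wv; rewrite wu /= => Nvw1 Nvw2.
have [/existsP[b]|/existsPn noB] :=
    boolP [exists b, [&& e1 w b, ~~ e1 u b, ~~ e2 u b & u != b]].
  by case/and4P=> wb ub1 ub2 ub; exists w, b; split=> //; split=> //; rewrite eq_sym.
(* With no suitable [b], a neighbour [s] of [w] other than [u] would be adjacent to [u] in one of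
   the graphs, which puts [w] in [F s] or in [N1 s], hence in [B]. *)
have only_u s : e1 w s -> s = u.
  move=> ws; apply/eqP; apply: contraT => su.
  have sv : s != v by apply: contraNneq Nvw1 => <-; rewrite sym1.
  have := noB s; rewrite ws [u == s]eq_sym su andbT /= negb_and !negbK => /orP[us|us].
    case/bigcupP: wF; exists s; rewrite ?inE ?sv // /F.
    by case: eqP => [/setP/(_ w)|_]; rewrite !inE wu sym1 ws.
  by case/bigcupP: wG; exists s; rewrite !inE ?sv // sym1.
(* Not being isolated, [w] is a leaf attached to [u], so [F w] is the singleton of [w] and again [w]
   lies in [B]. *)
have /andP[/card_gt0P[s]] := deg1 w; rewrite inE => ws _.
have uw : e1 u w by rewrite sym1 -(only_u s).
case/bigcupP: wF; exists w; first by rewrite !inE wv.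
rewrite /F ifT ?inE //; apply/eqP/setP=> y; rewrite !inE.
by apply/negP=> /andP[/eqP yu /only_u].
Qed.

(** Induction on the number of common edges, counted as ordered pairs. Only the first graph is
    switched, and its degree bounds persist because switching keeps degrees. *)
Lemma exists_edge_disjoint (e1 e2 : rel T) (D1 D2 : nat) :
    simple_graph e1 -> simple_graph e2 ->
    (forall x, 0 < degree e1 x <= D1) -> (forall x, degree e2 x <= D2) ->
    D1 <= D2 -> 2 * (D1 * D2) < #|T| ->
  exists e, [/\ simple_graph e, degree e =1 degree e1 & edge_disjoint e e2].
Proof.
move=> simple1 simple2 deg1 deg2 leD ltT.
pose common e := [set p : T * T | e p.1 p.2 && e2 p.1 p.2].
have [m] := ubnP #|common e1|; elim: m e1 simple1 deg1 => // m IHm.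
move=> e1 simple1 deg1 lem.
have [/existsP[[u v] /= /andP[uv1 uv2]]|/existsPn disj] :=
    boolP [exists p : T * T, e1 p.1 p.2 && e2 p.1 p.2]; last first.
  by exists e1; split=> // x y; exact: (disj (x, y)).
have [w [b [wb ub1 ub2 [vw1 vw2 uw vw ub]]]] :=
  exists_switch simple1 simple2 deg1 deg2 leD ltT uv1 uv2.
have [sym1 irr1] := simple1; have [sym2 irr2] := simple2.
have deg_s : degree (switch e1 u v w b) =1 degree e1 by exact: degree_switch.
have [|x||e [simple_e deg_e disj]] := IHm (switch e1 u v w b).
- exact: simple_switch.
- by rewrite deg_s.
(* The added edges [u b] and [v w] are not in [e2], so no common pair is created, while [(u, v)] is
   lost. *)
- apply: leq_trans (lem : _ <= m); apply: proper_card; apply/properP; split.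
    apply/subsetP=> -[x y]; rewrite !inE /= => /andP[+ xy2]; rewrite xy2 andbT.
    case/or3P=> [ | | /and3P[] //] /orP[] /andP[/eqP Ex /eqP Ey]; subst x y;
      by move: xy2; rewrite ?[e2 b u]sym2 ?[e2 w v]sym2 ?(negPf ub2) ?(negPf vw2).
  exists (u, v); rewrite !inE /= ?uv1 ?uv2 //.
  have uv : u != v by apply: contraTneq uv1 => ->; rewrite irr1.
  have vb : v != b by apply: contraNneq ub1 => <-.
  by rewrite /switch /same_pair !eqxx (negPf vb) (negPf uv) (negPf uw) (negPf ub) /= andbF.
by exists e; split=> // x; rewrite deg_e.
Qed.

End Switch.

Lemma realizes_degree_bounds (n : nat) (d : n.-tuple nat) (e : rel 'I_n) :
    sorted geq d -> realizes e d ->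
  forall i, nth 0 d n.-1 <= degree e i <= nth 0 d 0.
Proof.
move=> sorted_d [_ deg_e] i; rewrite deg_e (tnth_nth 0).
have geq_trans : transitive geq by move=> a b c /= ba ac; exact: leq_trans ac ba.
have mono := sorted_leq_nth geq_trans leqnn 0 sorted_d.
have lt_in : i < n := ltn_ord i.
by apply/andP; split; apply: mono; rewrite ?inE ?size_tuple //; lia.
Qed.

Lemma pack_sym (n : nat) (d1 d2 : n.-tuple nat) : pack d1 d2 -> pack d2 d1.
Proof.
move=> [e1 [e2 [r1 r2 disj]]]; exists e2, e1; split=> // x y.
by rewrite andbC; exact: disj.
Qed.

Theorem theorem8 (n : nat) (hn : 3 <= n) (d1 d2 : n.-tuple nat)
  (hg1 : graphic d1) (hg2 : graphic d2)
  (hmin1 : 1 <= nth 0 d1 n.-1) (hmin2 : 1 <= nth 0 d2 n.-1)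
  (hmax : ((nth 0%N d1 0 * nth 0%N d2 0)%N%:R < n%:R / 2 :> rat)%R) :
  pack d1 d2.
Proof.
have {hn} ltn : 2 * (nth 0 d1 0 * nth 0 d2 0) < n.
  by rewrite -(ltr_nat rat) natrM mulrC -ltr_pdivlMr.
move: hg1 hg2 hmin1 hmin2 ltn; clear hmax.
(* Packing is symmetric, so the graph to be switched may be taken to be the one with the smaller
   maximum degree, as the count of bad vertices requires. *)
wlog leD : d1 d2 / nth 0 d1 0 <= nth 0 d2 0 => [wlog_le|].
  move=> hg1 hg2 hmin1 hmin2 ltn.
  case: (leqP (nth 0 d1 0) (nth 0 d2 0)) => [|/ltnW] leD; first exact: wlog_le.
  by apply: pack_sym; apply: wlog_le => //; rewrite [X in 2 * X]mulnC.
move=> [sorted1 [e1 real1]] [sorted2 [e2 real2]] hmin1 _ ltn.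
have deg1 := realizes_degree_bounds sorted1 real1.
have deg2 := realizes_degree_bounds sorted2 real2.
have [simple1 eq1] := real1; have [simple2 _] := real2.
have [x|x|||e [simple_e deg_e disj]] :=
    @exists_edge_disjoint _ e1 e2 (nth 0 d1 0) (nth 0 d2 0) simple1 simple2.
- by have /andP[le1 ->] := deg1 x; rewrite (leq_trans hmin1).
- by have /andP[] := deg2 x.
- by [].
- by rewrite card_ord.
by exists e, e2; split=> //; split=> // i; rewrite deg_e.
Qed.
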